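(* Let $L \subseteq \{1,2,3,\dots\}$ be a nonempty set of labels, and let $V$ and $W$ be complete $L$-edge-labelled graphs. For every embedding $f : V \to W$ there is a group embedding $\gamma(f) : \gamma(V) \to \gamma(W)$ such that $\gamma(f)([v]) = [f(v)]$ for all $v \in V$. This turns $\gamma$ into a functor from the category of complete $L$-edge-labelled graphs and edge-labelled graph embeddings into the category of groups and group embeddings, which takes finite complete $L$-edge-labelled graphs to finite groups.
   Context: A complete $L$-edge-labelled graph is a nonempty set $V$ (of vertices) with a labelling function $\ell^V : \binom{V}{2} \to L$, where $\binom{V}{2}$ is the set of all 2-element subsets of $V$; the graph is identified with its vertex set. $V$ may be infinite. An embedding of complete $L$-edge-labelled graphs $f : V \to W$ is an (injective) function such that $\ell^V(\{u,v\}) = \ell^W(\{f(u),f(v)\})$ for all $\{u,v\} \in \binom{V}{2}$. A group embedding is an injective group homomorphism. For a positive integer $n$, the dihedral group of order $2n$ with generators $a,b$ is $D_n^{\{a,b\}} = \langle a,b \mid a^2 = 1, b^2 = 1, (ab)^n = (ba)^n = 1\rangle$. Also $D^{\{a\}} = \langle a \mid a^2 = 1\rangle$ is the cyclic group of order 2. Construction of $\gamma(V)$. Let $V$ be a complete $L$-edge-labelled graph. Put $I(V) = \{\{i,j\} : i,j \in V\}$ (including singletons, when $i=j$). For $i \ne j$ in $V$ let $m_{ij} = \ell^V(\{i,j\})$ and let $D^{\{i,j\}} = D^{\{i,j\}}_{2m_{ij}}$, the dihedral group of order $4m_{ij}$ generated by the involutions $i$ and $j$; for $i = j$ the factor is $D^{\{i\}}$,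 the cyclic group of order 2 generated by $i$. Let $\Pi(V) = \prod_{\{i,j\} \in I(V)} D^{\{i,j\}}$ be the full direct product, with coordinatewise operations. For $v \in V$ let $[v] \in \Pi(V)$ be the element with $[v](\{i,j\}) = v$ if $v \in \{i,j\}$ and $[v](\{i,j\}) = 1$ otherwise. Then $\gamma(V)$ is the subgroup of $\Pi(V)$ generated by $\{[v] : v \in V\}$. *)

(* Defs.v *)
From HB Require Import structures.
From mathcomp Require Import all_boot.
From mathcomp Require Import boolp classical_sets functions cardinality.

Set Implicit Arguments.
Unset Strict Implicit.
Unset Printing Implicit Defensive.

Import Algebra.

Local Open Scope classical_set_scope.
Local Open Scope group_scope.
Local Open Scope quotient_scope.

(* The letter (x, false) stands for the generator x, and (x, true) for its
   formal inverse. *)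
Definition word (X : Type) := seq (X * bool).
HB.instance Definition _ (X : Type) := gen_eqMixin (word X).
HB.instance Definition _ (X : Type) := gen_choiceMixin (word X).

Inductive pres_eq (X : Type) (R : set (word X)) : word X -> word X -> Prop :=
| pres_refl u : pres_eq R u u
| pres_sym u v : pres_eq R u v -> pres_eq R v u
| pres_trans u v w : pres_eq R u v -> pres_eq R v w -> pres_eq R u w
| pres_cancel u v x b :
    pres_eq R (u ++ [:: (x, b); (x, ~~ b)] ++ v) (u ++ v)
| pres_relator u v r : R r -> pres_eq R (u ++ r ++ v) (u ++ v).

Section Presentation.
Variables (X : Type) (R : set (word X)).

Definition pres_rel : rel (word X) := fun u v => `[< pres_eq R u v >].

Lemma pres_rel_equiv : equiv_class_of pres_rel.
Proof.
split=> [u|u v|v u w].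
- exact/asboolP/pres_refl.
- by apply/asboolP/asboolP; exact: pres_sym.
- by move=> /asboolP uv /asboolP vw; apply/asboolP; exact: pres_trans uv vw.
Qed.

Canonical pres_equiv := EquivRelPack pres_rel_equiv.

(* the group < X | R > *)
Definition presented := {eq_quot pres_equiv}.

HB.instance Definition _ := Choice.on presented.
HB.instance Definition _ := EqQuotient.on presented.

Definition pres_class (u : word X) : presented := \pi_presented u.

Lemma pres_reprK a : pres_class (repr a) = a.
Proof. exact: reprK. Qed.

Lemma pres_eqP (u v : word X) :
  pres_class u = pres_class v <-> pres_eq R u v.
Proof.
by split=> [/eqmodP/asboolP //|uv]; apply/eqmodP/asboolP.
Qed.

Definition inv_word (u : word X) : word X :=
  rev [seq (l.1, ~~ l.2) | l <- u].

Lemma pres_ctx a b u v : pres_eq R u v -> pres_eq R (a ++ u ++ b) (a ++ v ++ b).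
Proof.
elim=> {u v} [u|u v _ IH|u v w _ IH1 _ IH2|u v x c|u v r Rr].
- exact: pres_refl.
- exact: pres_sym.
- exact: pres_trans IH1 IH2.
- have := pres_cancel R (a ++ u) (v ++ b) x c.
  by rewrite -!catA.
- have := pres_relator (a ++ u) (v ++ b) Rr.
  by rewrite -!catA.
Qed.

Lemma pres_cat u u' v v' :
  pres_eq R u u' -> pres_eq R v v' -> pres_eq R (u ++ v) (u' ++ v').
Proof.
move=> uu' vv'; apply: (@pres_trans _ _ _ (u' ++ v)).
  exact: (@pres_ctx [::] v _ _ uu').
by have := @pres_ctx u' [::] _ _ vv'; rewrite !cats0.
Qed.

Lemma inv_wordK : involutive inv_word.
Proof.
move=> u; rewrite /inv_word map_rev revK -map_comp.
by rewrite (eq_map (g := id)) ?map_id // => -[x b] /=; rewrite negbK.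
Qed.

Lemma pres_mulV u : pres_eq R (u ++ inv_word u) [::].
Proof.
elim: u => [|[x b] u IH]; first exact: pres_refl.
have -> : ((x, b) :: u) ++ inv_word ((x, b) :: u) =
          [:: (x, b)] ++ (u ++ inv_word u) ++ [:: (x, ~~ b)].
  by rewrite /inv_word /= rev_cons -cats1 -!catA.
apply: pres_trans (pres_ctx _ _ IH) _.
exact: (pres_cancel R [::] [::]).
Qed.

Lemma pres_Vmul u : pres_eq R (inv_word u ++ u) [::].
Proof. by rewrite -{2}(inv_wordK u); exact: pres_mulV. Qed.

Lemma pres_inv u v : pres_eq R u v -> pres_eq R (inv_word u) (inv_word v).
Proof.
move=> uv; apply: (@pres_trans _ _ _ (inv_word u ++ (v ++ inv_word v))).
  rewrite -{1}(cats0 (inv_word u)).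
  by apply: pres_cat; [exact: pres_refl | apply/pres_sym/pres_mulV].
rewrite catA -{2}(cat0s (inv_word v)).
apply: pres_cat; last exact: pres_refl.
apply: pres_trans (pres_Vmul u).
by apply: pres_cat; [exact: pres_refl | exact: pres_sym].
Qed.

Lemma pres_repr u : pres_eq R (repr (pres_class u)) u.
Proof. by apply/pres_eqP; rewrite pres_reprK. Qed.

Definition pres_one : presented := pres_class [::].
Definition pres_mul (a b : presented) : presented :=
  pres_class (repr a ++ repr b).
Definition pres_invg (a : presented) : presented :=
  pres_class (inv_word (repr a)).

Lemma pres_mulE u v :
  pres_mul (pres_class u) (pres_class v) = pres_class (u ++ v).
Proof. by apply/pres_eqP; apply: pres_cat; exact: pres_repr. Qed.

Lemma pres_invE u : pres_invg (pres_class u) = pres_class (inv_word u).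
Proof. by apply/pres_eqP; apply: pres_inv; exact: pres_repr. Qed.

Lemma pres_mulgA : associative pres_mul.
Proof.
move=> a b c; rewrite -[a]pres_reprK -[b]pres_reprK -[c]pres_reprK.
rewrite (pres_mulE (repr b)) (pres_mulE (repr a) (repr b)).
by rewrite (pres_mulE (repr a)) pres_mulE catA.
Qed.

Lemma pres_mul1g : left_id pres_one pres_mul.
Proof. by move=> a; rewrite -[a]pres_reprK pres_mulE. Qed.

Lemma pres_mulg1 : right_id pres_one pres_mul.
Proof. by move=> a; rewrite -[a]pres_reprK pres_mulE cats0. Qed.

Lemma pres_mulVg : left_inverse pres_one pres_invg pres_mul.
Proof.
by move=> a; rewrite -[a]pres_reprK pres_invE pres_mulE; apply/pres_eqP; exact: pres_Vmul.
Qed.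

Lemma pres_mulgV : right_inverse pres_one pres_invg pres_mul.
Proof.
by move=> a; rewrite -[a]pres_reprK pres_invE pres_mulE; apply/pres_eqP; exact: pres_mulV.
Qed.

HB.instance Definition _ := isGroup.Build presented
  pres_mulgA pres_mul1g pres_mulg1 pres_mulVg pres_mulgV.

Definition pres_gen (x : X) : presented := pres_class [:: (x, false)].

End Presentation.

(* For X = {a, b} with a <> b, the second family of relators consists of (ab)^n
   and (ba)^n; for X = {a} it is empty, so that the presented group is
   < a | a^2 = 1 > whatever n is. *)
Definition dihedral_relators (X : Type) (n : nat) : set (word X) :=
  [set w | exists a : X, w = [:: (a, false); (a, false)]] `|`
  [set w | exists a b : X, a <> b /\
           w = flatten (nseq n [:: (a, false); (b, false)])].

Definition dihedral (X : Type) (n : nat) : groupType :=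
  presented (@dihedral_relators X n).

Definition dprod_group (I : Type) (G : I -> groupType) := forall i, G i.

Section DirectProduct.
Variables (I : Type) (G : I -> groupType).

HB.instance Definition _ := Choice.on (dprod_group G).

Definition dprod_one : dprod_group G := fun i => 1.
Definition dprod_mul (x y : dprod_group G) : dprod_group G :=
  fun i => x i * y i.
Definition dprod_inv (x : dprod_group G) : dprod_group G := fun i => (x i)^-1.

Lemma dprod_mulgA : associative dprod_mul.
Proof. by move=> x y z; apply: functional_extensionality_dep => i; exact: mulgA. Qed.

Lemma dprod_mul1g : left_id dprod_one dprod_mul.
Proof. by move=> x; apply: functional_extensionality_dep => i; exact: mul1g. Qed.

Lemma dprod_mulg1 : right_id dprod_one dprod_mul.
Proof. by move=> x; apply: functional_extensionality_dep => i; exact: mulg1. Qed.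

Lemma dprod_mulVg : left_inverse dprod_one dprod_inv dprod_mul.
Proof. by move=> x; apply: functional_extensionality_dep => i; exact: mulVg. Qed.

Lemma dprod_mulgV : right_inverse dprod_one dprod_inv dprod_mul.
Proof. by move=> x; apply: functional_extensionality_dep => i; exact: mulgV. Qed.

HB.instance Definition _ := isGroup.Build (dprod_group G)
  dprod_mulgA dprod_mul1g dprod_mulg1 dprod_mulVg dprod_mulgV.

End DirectProduct.

Definition subgroup (G : groupType) (H : set G) :=
  group_closed (fun x : G => x \in H).

Definition gen_subgroup (G : groupType) (S : set G) : set G :=
  smallest (@subgroup G) S.

Definition generated (G : groupType) (S : set G) := set_type (gen_subgroup S).

Section Generated.
Variables (G : groupType) (S : set G).

Lemma gen_subgroup_closed : subgroup (gen_subgroup S).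
Proof.
split=> [|x y]; first by apply/mem_set => H [[H1 _] _]; exact/set_mem.
move=> /set_mem Hx /set_mem Hy; apply/mem_set => H HS; have [[_ HV] _] := HS.
by apply/set_mem/HV; apply/mem_set; [exact: Hx | exact: Hy].
Qed.

HB.instance Definition _ := SubChoice.on (generated S).
HB.instance Definition _ := SubChoice_isSubGroup.Build G
  (fun x : G => x \in gen_subgroup S) (generated S) gen_subgroup_closed.

Lemma gen_subgroup_incl x : S x -> x \in gen_subgroup S.
Proof. by move=> Sx; apply/mem_set => H [_]; exact. Qed.

End Generated.

Definition binom2 (V : Type) :=
  {e : set V | exists u v, u <> v /\ e = [set u; v]}.

Definition edge (V : Type) (u v : V) (uv : u <> v) : binom2 V :=
  exist _ [set u; v] (ex_intro _ u (ex_intro _ v (conj uv erefl))).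

Record labelled_graph (L : set nat) := LabelledGraph {
  vertex :> Type;
  vertex_inhabited : inhabited vertex;
  label : binom2 vertex -> nat;
  label_in : forall e, L (label e)
}.

Record graph_embedding (L : set nat) (V W : labelled_graph L) :=
  GraphEmbedding {
  graph_map :> V -> W;
  graph_map_inj : injective graph_map;
  graph_map_label : forall (u v : V) (uv : u <> v)
    (fuv : graph_map u <> graph_map v), label (edge uv) = label (edge fuv)
}.

Record group_embedding (G H : groupType) := GroupEmbedding {
  group_map :> {multiplicative G -> H};
  group_map_inj : injective group_map
}.

Section Gamma.
Variables (L : set nat) (V : labelled_graph L).

Definition pairs := {p : set V | exists i j, p = [set i; j]}.

(* The value 0 on singletons is irrelevant, see dihedral_relators. *)
Definition pair_label (p : pairs) : nat :=
  match pselect (exists u v : V, u <> v /\ sval p = [set u; v]) with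
  | left e => label (exist _ (sval p) e)
  | right _ => 0%N
  end.

Definition factor (p : pairs) : groupType :=
  dihedral {v : V | sval p v} (2 * pair_label p)%N.

Definition full_product : groupType := dprod_group factor.

Definition bracket (v : V) : full_product := fun p : pairs =>
  match pselect (sval p v) with
  | left pv => pres_gen (dihedral_relators (2 * pair_label p)%N) (exist _ v pv)
  | right _ => 1
  end.

Definition gamma : groupType := generated (range bracket).

Lemma bracket_in_gamma v : bracket v \in gen_subgroup (range bracket).
Proof. by apply: gen_subgroup_incl; exists v. Qed.

Definition gamma_gen (v : V) : gamma := exist _ (bracket v) (bracket_in_gamma v).

End Gamma.

Record category := Category {
  ob :> Type;
  hom : ob -> ob -> Type;
  idm : forall A, hom A A;
  compm : forall A B C, hom B C -> hom A B -> hom A C;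
  compmA : forall A B C D (h : hom C D) (g : hom B C) (f : hom A B),
    compm h (compm g f) = compm (compm h g) f;
  comp1m : forall A B (f : hom A B), compm (idm B) f = f;
  compm1 : forall A B (f : hom A B), compm f (idm A) = f
}.

(* functor structures with a prescribed action F on objects *)
Record functor_on (C D : category) (F : C -> D) := FunctorOn {
  fmap : forall A B : C, hom A B -> hom (F A) (F B);
  fmap1 : forall A : C, fmap (idm A) = idm (F A);
  fmapM : forall (A B E : C) (g : hom B E) (f : hom A B),
    fmap (compm g f) = compm (fmap g) (fmap f)
}.

Section GraphCategory.
Variable L : set nat.

Lemma graph_embedding_ext (V W : labelled_graph L) (f g : graph_embedding V W) :
  f =1 g -> f = g.
Proof.
case: f g => f fi fl [g gi gl] /= /funext fg; subst g.
by congr GraphEmbedding; exact: Prop_irrelevance.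
Qed.

Definition graph_id (V : labelled_graph L) : graph_embedding V V.
Proof.
exists id; first exact: inj_id.
by move=> u v uv fuv; rewrite (Prop_irrelevance uv fuv).
Defined.

Definition graph_comp (U V W : labelled_graph L)
  (g : graph_embedding V W) (f : graph_embedding U V) : graph_embedding U W.
Proof.
exists (g \o f); first exact: inj_comp (@graph_map_inj _ _ _ g) (@graph_map_inj _ _ _ f).
move=> u v uv gfuv.
have fuv : f u <> f v by move=> e; apply: gfuv; rewrite /= e.
by rewrite (graph_map_label uv fuv) (graph_map_label fuv gfuv).
Defined.

Definition graph_cat : category.
Proof.
exists (labelled_graph L) (@graph_embedding L) graph_id graph_comp;
  by move=> *; exact: graph_embedding_ext.
Defined.

End GraphCategory.

Lemma group_embedding_ext (G H : groupType) (f g : group_embedding G H) :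
  f =1 g -> f = g.
Proof.
case: f g => [[f [[fM]]] fi] [[g [[gM]]] gi] /= /funext fg.
rewrite /= in fg; subst g.
have e : fM = gM by exact: Prop_irrelevance.
by subst gM; congr GroupEmbedding; exact: Prop_irrelevance.
Qed.

Definition group_id (G : groupType) : group_embedding G G :=
  GroupEmbedding (group_map := idfun) (@inj_id G).

Definition group_comp (G H K : groupType)
  (g : group_embedding H K) (f : group_embedding G H) : group_embedding G K :=
  GroupEmbedding (group_map := (g : {multiplicative H -> K}) \o
                               (f : {multiplicative G -> H}))
    (inj_comp (@group_map_inj _ _ g) (@group_map_inj _ _ f)).

Definition group_cat : category.
Proof.
exists groupType group_embedding group_id group_comp;
  by move=> *; exact: group_embedding_ext.
Defined.

(* Main.v *)
From HB Require Import structures.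
Require Import Defs.
From mathcomp Require Import all_boot.
From mathcomp Require Import boolp classical_sets functions cardinality.

(** The map gamma(f) is the restriction of a homomorphism defined on the whole
direct product.  For a pair p of vertices of W, the fiber f^-1(p) is either
empty or again a pair of vertices of V, because f is injective.  If it is
nonempty, then f induces a homomorphism from the factor at f^-1(p) to the
factor at p: when the fiber has two elements, the labels of the fiber and of p
agree, so the dihedral relators are sent to relators; when it has one element
i, the only relator is i^2, which is sent to f(i)^2.  Letting the coordinate
at p of the image of x be the image of x(f^-1(p)), or 1 when the fiber is
empty, gives a homomorphism Pi(V) -> Pi(W) ([full_product_mapM]) that sends
[v] to [f(v)] ([full_product_map_bracket]).

It is injective on all of Pi(V) ([full_product_map_inj]): a pair q of V is the
fiber of the pair f(q), all of whose elements lie in the image of f, so the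
factor at q is carried isomorphically to the factor at f(q).

Functoriality follows because a homomorphism out of gamma(V) is determined by
its values on the generators ([gamma_hom_ext]).  For finiteness, a group
generated by involutions a and b with (ab)^n = 1 and n > 0 consists of the
elements (ab)^k a^e with k < n and e in {0, 1} ([two_involutions_finite]), so
for finite V every factor is finite, there are finitely many factors, and
gamma(V) is a subset of a finite product. *)

Set Implicit Arguments.
Unset Strict Implicit.
Unset Printing Implicit Defensive.

Import Algebra.

Local Open Scope classical_set_scope.
Local Open Scope group_scope.

Lemma sval_inj (T : Type) (P : T -> Prop) : injective (@proj1_sig T P).
Proof. by move=> [x Px] [y Py] /=; exact: eq_exist. Qed.

(** * Homomorphisms between presented groups *)

(** The letterwise extension of [g] to words, respecting inverses. *)
Definition word_map (X Y : Type) (g : X -> Y) (u : word X) : word Y :=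
  [seq (g l.1, l.2) | l <- u].

Section PresentedMap.
Variables (X Y : Type) (R : set (word X)) (S : set (word Y)) (g : X -> Y).

(** Von Dyck's condition: [g] sends the relators of [R] to words that are
trivial modulo [S]. *)
Definition relator_map := forall r, R r -> pres_eq S (word_map g r) [::].

(** The map < X | R > -> < Y | S > induced by [g].  It is computed on a chosen
representative, hence is well behaved only under [relator_map]. *)
Definition presented_map (a : presented R) : presented S :=
  pres_class S (word_map g (repr a)).

Lemma pres_eq_map u v : relator_map ->
  pres_eq R u v -> pres_eq S (word_map g u) (word_map g v).
Proof.
move=> gRS; elim=> {u v} [u|u v _ IH|u v w _ IH1 _ IH2|u v x b|u v r Rr].
- exact: pres_refl.
- exact: pres_sym.
- exact: pres_trans IH1 IH2.
- by rewrite /word_map !map_cat; exact: pres_cancel.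
- rewrite /word_map !map_cat.
  exact: (pres_ctx (word_map g u) (word_map g v) (gRS _ Rr)).
Qed.

Lemma presented_mapE u : relator_map ->
  presented_map (pres_class R u) = pres_class S (word_map g u).
Proof.
by move=> gRS; apply/pres_eqP/pres_eq_map => //; exact: pres_repr.
Qed.

Lemma presented_map1 : relator_map -> presented_map 1 = 1.
Proof. by move=> gRS; rewrite [LHS](presented_mapE [::]). Qed.

Lemma presented_mapM : relator_map -> {morph presented_map : a b / a * b}.
Proof.
move=> gRS a b; rewrite -[a]pres_reprK -[b]pres_reprK.
rewrite [X in presented_map X](pres_mulE R) !presented_mapE//.
by rewrite [RHS](pres_mulE S) /word_map map_cat.
Qed.

Lemma presented_map_gen x : relator_map ->
  presented_map (pres_gen R x) = pres_gen S (g x).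
Proof. by move=> gRS; rewrite /pres_gen presented_mapE. Qed.

End PresentedMap.

Lemma presented_map_inj (X Y : Type) (R : set (word X)) (S : set (word Y))
    (g : X -> Y) (h : Y -> X) :
    cancel g h -> relator_map R S g -> relator_map S R h ->
  injective (@presented_map X Y R S g).
Proof.
move=> gK gRS hSR; apply: (can_inj (g := @presented_map Y X S R h)) => a.
rewrite -[a]pres_reprK !presented_mapE// /word_map -map_comp.
by congr pres_class; rewrite -[RHS]map_id; apply: eq_map => -[x b] /=; rewrite gK.
Qed.

Lemma pres_eq_relator (X : Type) (R : set (word X)) r :
  R r -> pres_eq R r [::].
Proof. by move=> Rr; have := pres_relator [::] [::] Rr; rewrite !cats0. Qed.

(** For two distinct generators the exponents [n] and [m] must agree; when [X]
has at most one element they are unrelated. *)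
Lemma dihedral_relator_map (X Y : Type) (n m : nat) (g : X -> Y) :
    (forall a b, a <> b -> g a <> g b /\ n = m) ->
  relator_map (@dihedral_relators X n) (@dihedral_relators Y m) g.
Proof.
move=> gP _ [[a ->]|[a [b [ab ->]]]].
  by apply: pres_eq_relator; left; exists (g a).
apply: pres_eq_relator; right.
have [gab ->] := gP _ _ ab; exists (g a), (g b); split=> //.
by rewrite /word_map map_flatten map_nseq.
Qed.

(** * Labels of pairs *)

Section PairLabel.
Variables (L : set nat) (V : labelled_graph L).

Lemma pairs_eq (p : pairs V) u v : u <> v -> sval p u -> sval p v ->
  sval p = [set u; v].
Proof.
have [i [j ->]] := svalP p => uv [] ui [] vi; rewrite ui vi // in uv *.
by rewrite setUC.
Qed.

Lemma pair_labelE (p : pairs V) u v (uv : u <> v) : sval p u -> sval p v ->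
  pair_label p = label (edge uv).
Proof.
move=> pu pv; have pE := pairs_eq uv pu pv.
rewrite /pair_label; case: pselect => [e|]; last by case; exists u, v.
by congr label; exact: eq_exist.
Qed.

End PairLabel.

(** * The homomorphism between full products *)

Section FullProductMap.
Variables (L : set nat) (V W : labelled_graph L) (f : graph_embedding V W).

(** The inverse image under [f] of a pair of vertices of [W]. *)
Definition fiber (p : pairs W) : set V := [set v | sval p (f v)].

Lemma fiber_pair_subproof (p : pairs W) : (exists v, fiber p v) ->
  exists i j, fiber p = [set i; j].
Proof.
have fI := @graph_map_inj _ _ _ f.
move=> [v pv].
have [[u [pu uv]]|nu] := pselect (exists u, fiber p u /\ f v <> f u).
  (* When a second vertex [u] is sent into p, p is {f v, f u}. *)
  exists v, u; have pE := pairs_eq uv pv pu.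
  apply/seteqP; split=> w; rewrite /fiber /= pE /=.
    by case=> /fI ->; [left|right].
  by case=> ->; [left|right].
exists v, v; apply/seteqP; split=> w; last by case=> ->.
move=> pw; left; apply: fI; apply/esym; apply: contrapT => vw.
by apply: nu; exists w.
Qed.

(** A nonempty fiber of a pair of vertices of [W], as a pair of vertices of
[V]. *)
Definition fiber_pair p (e : exists v, fiber p v) : pairs V :=
  exist _ (fiber p) (fiber_pair_subproof e).

(** The restriction of [f] to a fiber, from the generators of the factor at
the fiber to those of the factor at [p]. *)
Definition fiber_map p (e : exists v, fiber p v)
    (v : {v : V | sval (fiber_pair e) v}) : {w : W | sval p w} :=
  exist _ (f (sval v)) (svalP v).

Lemma fiber_pair_label p (e : exists v, fiber p v) u v : u <> v ->
  fiber p u -> fiber p v -> pair_label (fiber_pair e) = pair_label p.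
Proof.
move=> uv pu pv.
have fuv : f u <> f v by move/(@graph_map_inj _ _ _ f).
rewrite (@pair_labelE _ _ (fiber_pair e) u v uv)//.
by rewrite (@pair_labelE _ _ p (f u) (f v) fuv)// (graph_map_label uv fuv).
Qed.

Lemma fiber_map_relators p (e : exists v, fiber p v) :
  relator_map (dihedral_relators (2 * pair_label (fiber_pair e))%N)
              (dihedral_relators (2 * pair_label p)%N) (@fiber_map p e).
Proof.
apply: dihedral_relator_map => a b ab; split.
  by move=> /(congr1 sval) /(@graph_map_inj _ _ _ f)/sval_inj.
congr (2 * _)%N; apply: (@fiber_pair_label p e (sval a) (sval b)).
- by move/sval_inj.
- exact: svalP a.
- exact: svalP b.
Qed.

(** The homomorphism Pi(V) -> Pi(W): the coordinate at [p] is read off the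
coordinate at the fiber of [p], and is 1 when that fiber is empty. *)
Definition full_product_map (x : full_product V) : full_product W :=
  fun p => match pselect (exists v, fiber p v) with
           | left e => presented_map (dihedral_relators (2 * pair_label p)%N)
                         (@fiber_map p e) (x (fiber_pair e))
           | right _ => 1
           end.

Lemma full_product_mapM : {morph full_product_map : x y / x * y}.
Proof.
move=> x y; apply: functional_extensionality_dep => p.
rewrite [RHS]/(full_product_map x p * full_product_map y p) /full_product_map.
case: pselect => [e|_]; last exact/esym/mulg1.
exact: (presented_mapM (@fiber_map_relators p e)).
Qed.

Lemma full_product_map_bracket v :
  full_product_map (bracket v) = bracket (f v).
Proof.
apply: functional_extensionality_dep => p.
rewrite /full_product_map /bracket.
case: (pselect (sval p (f v))) => [pfv|npfv]; last first.
  case: (pselect (exists v, fiber p v)) => // e.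
  case: (pselect (sval (fiber_pair e) v)) => [//|_].
  exact: (presented_map1 (@fiber_map_relators p e)).
case: (pselect (exists v, fiber p v)) => [e|[]]; last by exists v.
case: (pselect (sval (fiber_pair e) v)) => // pv.
rewrite presented_map_gen; last exact: fiber_map_relators.
by congr pres_gen; apply: eq_exist.
Qed.

(** The inverse of the bijection from the fiber to [p] also respects the
relators, and induces a left inverse. *)
Lemma presented_fiber_map_inj p (e : exists v, fiber p v) :
    (forall w, sval p w -> exists v, f v = w) ->
  injective (presented_map (R := dihedral_relators (2 * pair_label (fiber_pair e))%N)
     (dihedral_relators (2 * pair_label p)%N) (@fiber_map p e)).
Proof.
move=> pf.
have inv_ex (w : {w | sval p w}) :
    exists v : {v | sval (fiber_pair e) v}, fiber_map v = w.
  case: w => w pw; have [v fv] := pf _ pw.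
  have pv : sval (fiber_pair e) v by rewrite /= /fiber /= fv.
  by exists (exist _ v pv); rewrite /fiber_map; apply: eq_exist.
pose h w := sval (cid (inv_ex w)).
have hK : cancel h (@fiber_map p e) by move=> w; exact: svalP (cid (inv_ex w)).
have fib_inj : injective (@fiber_map p e).
  by move=> a b /(congr1 sval) /(@graph_map_inj _ _ _ f)/sval_inj.
apply: (presented_map_inj (inj_can_sym hK fib_inj)); first exact: fiber_map_relators.
apply: dihedral_relator_map => a b ab.
have hab : h a <> h b by move/(can_inj hK).
split=> //; congr (2 * _)%N; apply/esym.
apply: (@fiber_pair_label p e (sval (h a)) (sval (h b))).
- by move/sval_inj.
- exact: svalP (h a).
- exact: svalP (h b).
Qed.

Lemma full_product_map_inj : injective full_product_map.
Proof.
move=> x y xy; apply: functional_extensionality_dep => q.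
have [i [j qE]] := svalP q.
(* Evaluate at the pair f(q), whose fiber is q. *)
pose p : pairs W := exist _ [set f i; f j] (ex_intro _ _ (ex_intro _ _ erefl)).
have := congr1 (fun z : full_product W => z p) xy; rewrite /full_product_map.
case: pselect => [e|[]]; last by exists i; left.
move=> /presented_fiber_map_inj; have -> : fiber_pair e = q.
  apply: sval_inj; rewrite qE; apply/seteqP; split=> v /=.
    by case=> /(@graph_map_inj _ _ _ f) ->; [left|right].
  by case=> ->; [left|right].
by apply=> w [->|->]; [exists i|exists j].
Qed.

End FullProductMap.

(** * Generated subgroups and their homomorphisms *)

Definition morph_hom (G H : groupType) (h : G -> H)
    (hM : {morph h : x y / x * y}) : {multiplicative G -> H} :=
  HB.pack h (isMultiplicative.Build G H h hM).

Section GroupMorphism.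
Variables (G H : groupType) (h : {multiplicative G -> H}).

Lemma morph_one : h 1 = 1.
Proof. by apply: (mulgI (h 1)); rewrite -gmulfM !mulg1. Qed.

Lemma morph_div x y : h (x / y) = h x / h y.
Proof. by apply: (mulIg (h y)); rewrite -gmulfM !mulgVK. Qed.

End GroupMorphism.

Section Generated.
Variables (G : groupType) (S : set G).

Lemma gen_subgroup_ind (P : set G) : subgroup P -> S `<=` P ->
  forall x, x \in gen_subgroup S -> P x.
Proof. by move=> Psub SP x /set_mem; apply. Qed.

Lemma gen_subgroup_morph (H : groupType) (T : set H) (h : {multiplicative G -> H}) x :
    (forall s, S s -> h s \in gen_subgroup T) ->
  x \in gen_subgroup S -> h x \in gen_subgroup T.
Proof.
move=> hST; have [T1 TF] := gen_subgroup_closed T.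
apply: (@gen_subgroup_ind [set x | h x \in gen_subgroup T]) => //.
split=> [|a b]; first by apply/mem_set; rewrite /= morph_one.
by move=> /set_mem ha /set_mem hb; apply/mem_set; rewrite /= morph_div; exact: TF.
Qed.

Lemma generated_hom_ext (H : groupType) (h k : {multiplicative generated S -> H}) :
    (forall s (sS : s \in gen_subgroup S), S s ->
       h (exist _ s sS) = k (exist _ s sS)) ->
  h =1 k.
Proof.
move=> hk [x xS].
pose el x xS : generated S := exist _ x xS.
pose P := [set x | exists xS : x \in gen_subgroup S,
  h (el x xS) = k (el x xS)].
have /(_ x xS) : forall x, x \in gen_subgroup S -> P x; last first.
  by move=> [xS']; rewrite (bool_irrelevance xS' xS).
apply: gen_subgroup_ind => [|s Ss]; last first.
  by have sS := gen_subgroup_incl Ss; exists sS; exact: hk.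
have [one_in F_in] := gen_subgroup_closed S.
split=> [|a b /set_mem[aS hka] /set_mem[bS hkb]]; apply/mem_set.
  exists one_in.
  have -> : el 1 one_in = 1 by exact: val_inj.
  by rewrite !morph_one.
exists (F_in _ _ aS bS).
have -> : el _ (F_in _ _ aS bS) = el a aS / el b bS by exact: val_inj.
by rewrite !morph_div hka hkb.
Qed.

End Generated.

(** * The functor gamma *)

Section GammaMap.
Variables (L : set nat) (V W : labelled_graph L) (f : graph_embedding V W).

Lemma gamma_map_subproof (x : gamma V) :
  full_product_map f (val x) \in gen_subgroup (range (@bracket L W)).
Proof.
apply: (gen_subgroup_morph (h := morph_hom (full_product_mapM f)) _ (valP x)).
move=> _ [v _ <-]; rewrite /= full_product_map_bracket.
exact: bracket_in_gamma.
Qed.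

(** The restriction of [full_product_map] to the subgroup gamma(V). *)
Definition gamma_map (x : gamma V) : gamma W :=
  exist _ (full_product_map f (val x)) (gamma_map_subproof x).

Lemma gamma_mapM : {morph gamma_map : x y / x * y}.
Proof. by move=> x y; apply: val_inj; exact: full_product_mapM. Qed.

Lemma gamma_map_inj : injective gamma_map.
Proof.
by move=> x y /(congr1 val) /full_product_map_inj /val_inj.
Qed.

(** The group embedding gamma(f). *)
Definition gamma_embedding : group_embedding (gamma V) (gamma W) :=
  GroupEmbedding (group_map := morph_hom gamma_mapM) gamma_map_inj.

Lemma gamma_embedding_gen v : gamma_embedding (gamma_gen v) = gamma_gen (f v).
Proof. by apply: val_inj; exact: full_product_map_bracket. Qed.

End GammaMap.

Lemma gamma_hom_ext (L : set nat) (V : labelled_graph L) (H : groupType)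
    (h k : {multiplicative gamma V -> H}) :
  (forall v, h (gamma_gen v) = k (gamma_gen v)) -> h =1 k.
Proof.
move=> hk; apply: generated_hom_ext => s sV [v _ vs].
have -> : exist _ s sV = gamma_gen v by apply: val_inj; rewrite /= vs.
exact: hk.
Qed.

Section Functor.
Variable L : set nat.

Lemma gamma_embedding_id (V : labelled_graph L) :
  gamma_embedding (graph_id V) = group_id (gamma V).
Proof.
apply: group_embedding_ext; apply: gamma_hom_ext => v.
exact: gamma_embedding_gen.
Qed.

Lemma gamma_embedding_comp (U V W : labelled_graph L)
    (g : graph_embedding V W) (f : graph_embedding U V) :
  gamma_embedding (graph_comp g f) =
  group_comp (gamma_embedding g) (gamma_embedding f).
Proof.
apply: group_embedding_ext; apply: gamma_hom_ext => v.
transitivity (gamma_gen (g (f v))); first exact: gamma_embedding_gen.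
transitivity (gamma_embedding g (gamma_gen (f v))).
  by rewrite gamma_embedding_gen.
by congr (gamma_embedding g _); rewrite gamma_embedding_gen.
Qed.

(** The functor acting as [gamma] on objects and as [gamma_embedding] on
morphisms. *)
Definition gamma_functor : @functor_on (graph_cat L) group_cat (@gamma L) :=
  @FunctorOn (graph_cat L) group_cat (@gamma L) (@gamma_embedding L)
    gamma_embedding_id gamma_embedding_comp.

End Functor.

(** * Finiteness *)

Section TwoInvolutions.
Variables (G : groupType) (a b : G) (n : nat).
Hypotheses (aa : a * a = 1) (bb : b * b = 1).
Hypotheses (n_gt0 : (0 < n)%N) (abn : (a * b) ^+ n = 1).

(** The hypothesis, an induction principle, says that [a] and [b] generate [G]; since they are
involutions, left multiplication by [a] and [b] suffices. *)
Lemma two_involutions_finite :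
    (forall P : set G, P 1 -> (forall x, P x -> P (a * x)) ->
       (forall x, P x -> P (b * x)) -> P = setT) ->
  finite_set [set: G].
Proof.
move=> ind; pose nf (k : 'I_n * bool) := (a * b) ^+ k.1 * a ^+ k.2.
suff <- : range nf = setT by apply: finite_image; exact: finite_finset.
have nfP k (c : bool) : range nf ((a * b) ^+ k * a ^+ c).
  exists (Ordinal (ltn_pmod k n_gt0), c) => //; rewrite /nf /=; congr (_ * _).
  by rewrite {2}(divn_eq k n) expgnDr mulnC expgnA abn expg1n mul1g.
(* (ab)^(n-1) is the inverse of ab, and a inverts ab by conjugation. *)
have ar : a * (a * b) = (a * b) ^+ n.-1 * a.
  have -> : a * (a * b) = b by rewrite mulgA aa mul1g.
  have -> : (a * b) ^+ n.-1 * a = (a * b) ^+ n.-1 * (a * b) * b.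
    by rewrite -!mulgA bb mulg1.
  by rewrite -expgSr prednK// abn mul1g.
have aE k (c : bool) :
    a * ((a * b) ^+ k * a ^+ c) = (a * b) ^+ (n.-1 * k) * a ^+ (~~ c).
  rewrite mulgA; have -> : a * (a * b) ^+ k = (a * b) ^+ (n.-1 * k) * a.
    rewrite expgnA; elim: k => [|k IH]; first by rewrite !expg0 mulg1 mul1g.
    by rewrite !expgSr mulgA IH -!mulgA ar.
  by rewrite -mulgA; case: c; rewrite /= ?expg0 ?expg1 ?aa ?mulg1.
apply: ind => [|_ [[k c] _ <-]|_ [[k c] _ <-]].
- by have := nfP 0%N false; rewrite !expg0 mulg1.
- by rewrite aE; exact: nfP.
- (* Since b = a (ab), this case reduces to multiplication by a. *)
  have -> : b * nf (k, c) = a * ((a * b) ^+ k.+1 * a ^+ c).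
    by rewrite expgS !mulgA aa mul1g.
  by rewrite aE; exact: nfP.
Qed.

End TwoInvolutions.

Section DihedralFinite.
Variables (X : Type) (n : nat).
Let R := @dihedral_relators X n.

Lemma dihedral_gen_invol (x : X) : pres_gen R x * pres_gen R x = 1.
Proof.
rewrite [LHS](pres_mulE R); apply/pres_eqP/pres_eq_relator.
by left; exists x.
Qed.

Lemma dihedral_genM_expg (x y : X) :
  x <> y -> (pres_gen R x * pres_gen R y) ^+ n = 1.
Proof.
move=> xy; have -> : (pres_gen R x * pres_gen R y) ^+ n =
    pres_class R (flatten (nseq n [:: (x, false); (y, false)])).
  elim: n => [//|m IH]; rewrite expgS IH.
  by rewrite [pres_gen _ _ * _](pres_mulE R) [LHS](pres_mulE R).
apply/pres_eqP/pres_eq_relator.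
by right; exists x, y.
Qed.

Lemma dihedral_ind (P : set (dihedral X n)) :
    P 1 -> (forall x a, P a -> P (pres_gen R x * a)) ->
  P = setT.
Proof.
move=> P1 PM; apply/seteqP; split=> // a _.
rewrite -[a]pres_reprK; elim: (repr a) => [//|[x b] u IH].
suff <- : pres_gen R x * pres_class R u = pres_class R ((x, b) :: u) by exact: PM.
case: b; last exact: (pres_mulE R [:: _]).
have -> : pres_gen R x = (pres_gen R x)^-1.
  by apply: (mulgI (pres_gen R x)); rewrite mulgV dihedral_gen_invol.
rewrite [_^-1](pres_invE R); exact: (pres_mulE R [:: _]).
Qed.

(** [X] has at most two elements; when [x = y], [n] is arbitrary and the group
is cyclic of order 2. *)
Lemma dihedral_finite (x y : X) :
    (forall z, z = x \/ z = y) -> (x <> y -> (0 < n)%N) ->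
  finite_set [set: dihedral X n].
Proof.
move=> xyP n_gt0.
have ind (P : set (dihedral X n)) : P 1 ->
    (forall a, P a -> P (pres_gen R x * a)) ->
    (forall a, P a -> P (pres_gen R y * a)) -> P = setT.
  by move=> P1 Px Py; apply: dihedral_ind => // z a; case: (xyP z) => ->; auto.
have xx := dihedral_gen_invol x; have yy := dihedral_gen_invol y.
have [xy|xy] := pselect (x = y).
  (* The product of the two equal involutions is 1, so the exponent 1 works. *)
  apply: (two_involutions_finite xx yy (n := 1)) ind => //.
  by rewrite expg1 -xy.
exact: (two_involutions_finite xx yy (n_gt0 xy) (dihedral_genM_expg xy)) ind.
Qed.

End DihedralFinite.

Lemma finite_dprod (I : Type) (G : I -> Type) :
    finite_set [set: I] -> (forall i, finite_set [set: G i]) ->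
  finite_set [set: forall i, G i].
Proof.
move=> finI finG.
have [[x0 _]|noG] := pselect (exists x : forall i, G i, True); last first.
  by rewrite (_ : setT = set0)//; apply/seteqP; split=> // x _; apply: noG; exists x.
pose J : choiceType := {classic I}.
have [s sE] : exists s : seq J, [set: J] = [set` s] by exact/finite_seqP.
(* Induction on the list of indices at which x may differ from x0. *)
pose S (r : seq J) := [set x : forall i : J, G i | forall i, i \notin r -> x i = x0 i].
suff finS r : finite_set (S r).
  apply: sub_finite_set (finS s) => x _ i /negP[].
  by have : [set: J] i by []; rewrite sE.
elim: r => [|i r IH].
  apply: sub_finite_set (finite_set1 (x0 : forall i : J, G i)) => x Sx.
  by apply: functional_extensionality_dep => i; exact: Sx.
apply: sub_finite_set
  (finite_image (fun gy => dfwith gy.2 gy.1) (finite_setX (finG i) IH)) => x Sx.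
exists (x i, dfwith (x : forall i : J, G i) (x0 i)); first split=> //= j jr.
  case: dfwithP jr => [//|k ik kr]; apply: Sx.
  by rewrite inE eq_sym negb_or ik.
apply: functional_extensionality_dep => j; case: dfwithP => [//|k ik].
by rewrite /= dfwith_out.
Qed.

Lemma finite_gamma (L : set nat) (L_pos : forall n, L n -> (0 < n)%N)
    (V : labelled_graph L) :
  finite_set [set: V] -> finite_set [set: gamma V].
Proof.
move=> finV.
have fin_pairs : finite_set [set: pairs V].
  pose mk (ij : V * V) : pairs V :=
    exist _ [set ij.1; ij.2] (ex_intro _ _ (ex_intro _ _ erefl)).
  have <- : mk @` (setT `*` setT) = setT.
    apply/seteqP; split=> // p _; have [i [j pE]] := svalP p.
    by exists (i, j) => //; apply: sval_inj; rewrite pE.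
  by apply: finite_image; exact: finite_setX.
have fin_factor (p : pairs V) : finite_set [set: factor p].
  have [i [j pE]] := svalP p.
  have pi : sval p i by rewrite pE; left.
  have pj : sval p j by rewrite pE; right.
  apply: (@dihedral_finite _ _ (exist _ i pi) (exist _ j pj)).
    move=> [z pz]; have := pz; rewrite {1}pE.
    by case=> zE; [left|right]; exact: eq_exist.
  move=> ij; have {}ij : i <> j by move=> e; apply: ij; exact: eq_exist.
  rewrite muln_gt0 /= (pair_labelE ij pi pj).
  by apply: L_pos; apply: label_in.
have finP : finite_set [set: full_product V] by exact: finite_dprod.
exact: (finite_preimage (in2W val_inj) finP).
Qed.

Theorem theorem3p2 (L : set nat) (L_neq0 : exists n : nat, L n)
    (L_pos : forall n : nat, L n -> 0 < n) :
  exists Gamma : @functor_on (graph_cat L) group_cat (@gamma L),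
    (forall (V W : labelled_graph L) (f : graph_embedding V W) (v : V),
       group_map (@fmap _ _ _ Gamma V W f) (gamma_gen v) = gamma_gen (f v)) /\
    (forall V : labelled_graph L,
       finite_set (@setT V) -> finite_set (@setT (gamma V))).
Proof.
exists (gamma_functor L); split.
  by move=> V W f v; exact: gamma_embedding_gen.
exact: finite_gamma L_pos.
Qed.
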